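(* Let $R$ be any (associative, not necessarily unital) ring. Then the map $$\mathrm{Lat}_{\mathrm d}(R)\longrightarrow \mathrm{Lat}(\mathrm S\mathcal Q(R)),\qquad I\longmapsto (\Lambda_R(I),\mathrm S(I))$$ is a lattice isomorphism, and a decomposable ideal $I\in\mathrm{Lat}_{\mathrm d}(R)$ is quasipure if and only if $\mathrm S(I)$ is cofinal in $\Lambda_R(I)$.
   Context: Rings are associative and not necessarily unital. $M_\infty(R)$ is the ring of infinite matrices over $R$ with finitely many nonzero entries. For $x,y\in M_\infty(R)$, $x\precsim_1 y$ means $x=syt$ for some $s,t\in M_\infty(R)$. $x\oplus y$ denotes the infinite matrix represented by the block diagonal matrix $\mathrm{diag}(x,y)$, where $x,y$ are replaced by finite square upper-left corners containing all their nonzero entries. $T(R)=\{(x_n)_{n\ge1}: x_n\in M_\infty(R),\ x_n\precsim_1 x_{n+1}\ \forall n\}$, and $\mathcal S(R)=\{(x_n)\in T(R): \forall n\ \exists y_{n+1}\in M_\infty(R),\ x_n=y_{n+1}x_{n+1}x_n\}$. For $(x_n),(y_n)\in T(R)$ write $(x_n)\precsim(y_n)$ if for every $n$ there is $m$ with $x_n\precsim_1 y_m$, and $(x_n)\sim(y_n)$ if $(x_n)\precsim (y_n)$ and $(y_n)\precsim(x_n)$. Put $\Lambda(R)=T(R)/{\sim}$ and $\mathrm S(R)=\mathcal S(R)/{\sim}\subseteq\Lambda(R)$. With the order induced by $\precsim$ and addition $[(x_n)]+[(y_n)]=[(x_n\oplus y_n)]$ both are positively ordered commutative monoids in which increasing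 sequences have suprema. Put $\mathrm S\mathcal Q(R)=(\Lambda(R),\mathrm S(R))$. An ideal of $\Lambda(R)$ is a (nonempty) subsemigroup $J$ which is downward hereditary ($x\le y\in J$ implies $x\in J$) and closed under suprema of increasing sequences. An ideal of the pair $\mathrm S\mathcal Q(R)=(\Lambda(R),\mathrm S(R))$ is a pair $(J,J\cap \mathrm S(R))$ with $J$ an ideal of $\Lambda(R)$; $\mathrm{Lat}(\mathrm S\mathcal Q(R))$ is the lattice of these, ordered by inclusion in both components. A two-sided ideal $I$ of $R$ is decomposable if for every $x\in M_\infty(I)$ there is $y\in M_\infty(I)$ with $x\precsim_1 y$ in $M_\infty(R)$; $\mathrm{Lat}_{\mathrm d}(R)$ is the lattice (under inclusion) of decomposable two-sided ideals. $I$ is quasipure if for every $x\in M_\infty(I)$ there are $s,y\in M_\infty(I)$ with $sy=y$ and $x\precsim_1 y$ in $M_\infty(R)$. For a two-sided ideal $I$ of $R$: $\Lambda_R(I)=\{[(x_n)]\in\Lambda(R): x_n\in M_\infty(I)\ \forall n\}$ and $\mathrm S(I)=\mathrm S(R)\cap\Lambda_R(I)$ (which identifies with the semigroup $\mathrm S$ of the ring $I$). A subset $X$ of a partially ordered set $P$ is cofinal if every $p\in P$ satisfies $p\le x$ for some $x\in X$. *)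

(* Defs.v *)
From HB Require Import structures.
From mathcomp Require Import all_boot order ssralg generic_quotient.
From mathcomp Require Import finmap boolp classical_sets.

Set Implicit Arguments.
Unset Strict Implicit.
Unset Printing Implicit Defensive.

Import Order.TTheory GRing.Theory.

Local Open Scope classical_set_scope.
Local Open Scope ring_scope.

Reserved Notation "x ** y" (at level 40, left associativity).
Reserved Notation "x *oo y" (at level 40, left associativity).

(* MathComp rings have a unit, so rings that need not have one are built
   directly on top of abelian groups. *)
HB.mixin Record Zmodule_isRng R of GRing.Zmodule R := {
  rng_mul : R -> R -> R;
  rng_mulA : associative rng_mul;
  rng_mulDl : left_distributive rng_mul +%R;
  rng_mulDr : right_distributive rng_mul +%R;
}.

#[short(type="rngType")]
HB.structure Definition Rng := {R of Zmodule_isRng R & GRing.Zmodule R}.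

Notation "x ** y" := (rng_mul x y) : ring_scope.

Section RngTheory.
Variable R : rngType.
Implicit Types x y z : R.

Lemma rng_mul0r x : 0 ** x = 0.
Proof. by apply: (addrI (0 ** x)); rewrite -rng_mulDl !addr0. Qed.

Lemma rng_mulr0 x : x ** 0 = 0.
Proof. by apply: (addrI (x ** 0)); rewrite -rng_mulDr !addr0. Qed.

Lemma rng_suml n (F : 'I_n -> R) x :
  (\sum_(i < n) F i) ** x = \sum_(i < n) F i ** x.
Proof.
apply: (big_morph (fun y => y ** x)) => [y z|]; first exact: rng_mulDl.
exact: rng_mul0r.
Qed.

Lemma rng_sumr n (F : 'I_n -> R) x :
  x ** (\sum_(i < n) F i) = \sum_(i < n) x ** F i.
Proof.
apply: (big_morph (fun y => x ** y)) => [y z|]; first exact: rng_mulDr.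
exact: rng_mulr0.
Qed.

(* Without a unit, stability under opposites has to be required. *)
Definition two_sided_ideal (I : set R) :=
  [/\ I 0, forall x y, I x -> I y -> I (x - y),
      forall r x, I x -> I (r ** x) & forall x r, I x -> I (x ** r)].

Lemma ideal_add (I : set R) x y : two_sided_ideal I -> I x -> I y -> I (x + y).
Proof.
case=> I0 IB _ _ Ix Iy; rewrite -[y]opprK; apply: (IB) => //.
by rewrite -[- y]add0r; apply: IB.
Qed.

End RngTheory.

Notation "''Moo' ( R )" := {fsfun nat * nat -> R with 0}
  (at level 8, format "''Moo' ( R )") : type_scope.

Section InfiniteMatrices.
Variable R : rngType.
Implicit Types x y z s t a b u v : 'Moo(R).

(* The size of the smallest square upper-left corner of x containing all its
   nonzero entries. *)
Definition corner x : nat := \max_(p <- finsupp x) (maxn p.1 p.2).+1.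

Definition moo_of (n : nat) (F : nat -> nat -> R) : 'Moo(R) :=
  [fsfun p in [fset ((val i, val j) : nat * nat) | i in 'I_n, j in 'I_n]%fset
     => F p.1 p.2].

Definition moo_mul x y : 'Moo(R) :=
  moo_of (maxn (corner x) (corner y))
    (fun i j => \sum_(k < corner x) x (i, val k) ** y (val k, j)).

Local Notation "x *oo y" := (moo_mul x y).

(* The block matrix diag(x, y), where x is replaced by its upper-left m x n
   corner. *)
Definition moo_block (m n : nat) x y : 'Moo(R) :=
  moo_of (m + n + (corner x + corner y))
    (fun i j => if (i < m)%N && (j < n)%N then x (i, j)
                else if (m <= i)%N && (n <= j)%N then y (i - m, j - n)%N
                else 0).

Definition moo_dsum x y : 'Moo(R) := moo_block (corner x) (corner x) x y.

Definition precsim1 x y : Prop := exists s t, x = s *oo y *oo t.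

Lemma moo_ext x y : (forall i j, x (i, j) = y (i, j)) -> x = y.
Proof. by move=> E; apply/fsfunP => -[i j]. Qed.

Lemma corner_out x i j : ((corner x <= i) || (corner x <= j))%N -> x (i, j) = 0.
Proof.
move=> out; apply: fsfun_dflt; apply/negP => ij.
have : ((maxn i j).+1 <= corner x)%N by exact: (@leq_bigmax_seq _ _ _ (fun p => (maxn p.1 p.2).+1) (i, j)).
by rewrite gtn_max => /andP[li lj]; move: out; rewrite leqNgt li leqNgt lj.
Qed.

Lemma moo_ofE n F i j :
  moo_of n F (i, j) = if (i < n)%N && (j < n)%N then F i j else 0.
Proof.
rewrite fsfunE; case: ifP => [/imfset2P[i' _ [j' _ [-> ->]]]|].
  by rewrite !ltn_ord.
case: ifP => // /andP[li lj] /negP[]; apply/imfset2P.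
by exists (Ordinal li) => //; exists (Ordinal lj).
Qed.

Lemma sum_cut (f : nat -> R) m n : (m <= n)%N ->
  (forall k, (m <= k)%N -> f k = 0) -> \sum_(k < n) f k = \sum_(k < m) f k.
Proof.
move=> mn f0; rewrite -(subnKC mn) big_split_ord /= [X in _ + X]big1 ?addr0 //.
by move=> k _; apply: f0; rewrite leq_addr.
Qed.

Lemma moo_mulE x y n i j :
    (forall k, (n <= k)%N -> x (i, k) ** y (k, j) = 0) ->
  (x *oo y) (i, j) = \sum_(k < n) x (i, val k) ** y (val k, j).
Proof.
pose f k := x (i, k) ** y (k, j).
move=> fn; rewrite moo_ofE.
have fc k : (corner x <= k)%N -> f k = 0.
  by move=> ck; rewrite /f corner_out ?ck ?orbT // rng_mul0r.
transitivity (\sum_(k < maxn (corner x) n) f k); last first.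
  by apply: sum_cut fn; rewrite leq_maxr.
have -> : \sum_(k < maxn (corner x) n) f k = \sum_(k < corner x) f k.
  by apply: sum_cut fc; rewrite leq_maxl.
case: ifP => // /negbT; rewrite negb_and -!leqNgt => /orP[] out.
  rewrite big1 // => k _; rewrite /f (@corner_out x) ?rng_mul0r //.
  by rewrite (leq_trans _ out) ?leq_maxl.
rewrite big1 // => k _; rewrite /f (@corner_out y) ?rng_mulr0 //.
by rewrite (leq_trans _ out) ?leq_maxr ?orbT.
Qed.

Lemma moo_mulEl x y n i j : (corner x <= n)%N ->
  (x *oo y) (i, j) = \sum_(k < n) x (i, val k) ** y (val k, j).
Proof.
move=> xn; apply: moo_mulE => k nk.
by rewrite corner_out ?rng_mul0r // (leq_trans xn nk) orbT.
Qed.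

Lemma moo_mulEr x y n i j : (corner y <= n)%N ->
  (x *oo y) (i, j) = \sum_(k < n) x (i, val k) ** y (val k, j).
Proof.
move=> yn; apply: moo_mulE => k nk.
by rewrite (@corner_out y) ?rng_mulr0 // (leq_trans yn nk).
Qed.

Lemma moo_mulA : associative moo_mul.
Proof.
move=> x y z; apply: moo_ext => i j.
rewrite (@moo_mulEl x _ (corner x)) // (@moo_mulEr _ z (corner z)) //.
under eq_bigr => k _ do rewrite (@moo_mulEr y z (corner z)) // rng_sumr.
rewrite exchange_big; apply: eq_bigr => l _.
rewrite (@moo_mulEl x y (corner x)) // rng_suml.
by apply: eq_bigr => k _; rewrite rng_mulA.
Qed.

Lemma precsim1_trans : forall y x z, precsim1 x y -> precsim1 y z -> precsim1 x z.
Proof.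
move=> y x z [s [t ->]] [s' [t' ->]]; exists (s *oo s'), (t' *oo t).
by rewrite !moo_mulA.
Qed.

Lemma ltn_addl_false m n : (m + n < m)%N = false.
Proof. by rewrite ltnNge leq_addr. Qed.

Lemma moo_blockE m n x y i j : moo_block m n x y (i, j) =
  if (i < m)%N then if (j < n)%N then x (i, j) else 0
  else if (j < n)%N then 0 else y (i - m, j - n)%N.
Proof.
rewrite moo_ofE; have [im|mi] := ltnP i m; have [jn|nj] := ltnP j n => /=.
- by rewrite -addnA !(leq_trans im) ?leq_addr //= (leq_trans jn) // addnCA leq_addr.
- by case: ifP.
- by case: ifP.
- case: ifP => // /negbT; rewrite negb_and -!leqNgt => out.
  rewrite corner_out //; apply/orP; case/orP: out => out; [left|right].
  + by rewrite leq_subRL // (leq_trans _ out) // -addnA leq_add2l !addnA leq_addl.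
  + rewrite leq_subRL // (leq_trans _ out) // [(m + n)%N]addnC -addnA leq_add2l.
    by rewrite !addnA leq_addl.
Qed.

Lemma moo_block_mul m n p a b c d :
    (forall i j k, (n <= k)%N -> a (i, k) ** b (k, j) = 0) ->
  moo_block m n a c *oo moo_block n p b d = moo_block m p (a *oo b) (c *oo d).
Proof.
move=> ab; apply: moo_ext => i j.
rewrite moo_blockE (@moo_mulEl _ _ (n + maxn (corner c) (corner (moo_block m n a c)))); last first.
  by rewrite (leq_trans (leq_maxr (corner c) _)) ?leq_addl.
rewrite big_split_ord /=.
under eq_bigr => k _ do rewrite !moo_blockE ltn_ord.
under [X in _ + X]eq_bigr => k _ do
  rewrite !moo_blockE ltn_addl_false /= addKn.
have [im|mi] := ltnP i m; have [jp|pj] := ltnP j p.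
- rewrite [X in _ + X]big1 ?addr0 => [|k _]; last by rewrite rng_mul0r.
  by rewrite (@moo_mulE a b n) // => k; exact: ab.
- rewrite !big1 ?addr0 // => k _; first by rewrite rng_mul0r.
  by rewrite rng_mulr0.
- rewrite !big1 ?addr0 // => k _; first by rewrite rng_mulr0.
  by rewrite rng_mul0r.
- rewrite big1 ?add0r => [|k _]; last by rewrite rng_mul0r.
  by rewrite -(@moo_mulEl c d _ _ _ (leq_maxl _ _)).
Qed.

Lemma precsim1_block m n x y x' y' :
    (corner x' <= n)%N -> precsim1 x x' -> precsim1 y y' ->
  precsim1 (moo_block m m x y) (moo_block n n x' y').
Proof.
move=> xn [s [t ->]] [u [v ->]].
exists (moo_block m n s u), (moo_block n m t v).
rewrite !moo_block_mul // => i j k nk.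
  rewrite (@moo_mulEr _ x' (corner x')) // big1 ?rng_mul0r // => l _.
  by rewrite (@corner_out x') ?rng_mulr0 // (leq_trans xn nk) orbT.
by rewrite (@corner_out x') ?rng_mulr0 // (leq_trans xn nk).
Qed.

Lemma precsim1_dsum x y x' y' : precsim1 x x' -> precsim1 y y' ->
  precsim1 (moo_dsum x y) (moo_dsum x' y').
Proof. exact: precsim1_block. Qed.

Lemma precsim1_add x a b a' b' : (forall i j, x (i, j) = a (i, j) + b (i, j)) ->
  precsim1 a a' -> precsim1 b b' -> precsim1 x (moo_dsum a' b').
Proof.
move=> xE [s [t aE]] [u [v bE]]; rewrite {}aE {}bE in xE.
set n := corner a'.
pose K := maxn (maxn (corner s) (corner t)) (maxn (corner u) (corner v)).
pose N := (n + K)%N.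
have lN z : (corner z <= K)%N ->
    (n + corner z <= N)%N by move=> zK; rewrite /N leq_add2l.
pose S := moo_of N (fun i j => if (j < n)%N then s (i, j) else u (i, j - n)%N).
pose T := moo_of N (fun i j => if (i < n)%N then t (i, j) else v (i - n, j)%N).
have big z i : (corner z <= K)%N ->
    (N <= i)%N -> (corner z <= i)%N.
  by move=> /lN zN Ni; rewrite (leq_trans _ Ni) // (leq_trans _ zN) // leq_addl.
have ls : (corner s <= K)%N by rewrite !leq_max leqnn ?orbT.
have lt : (corner t <= K)%N by rewrite !leq_max leqnn ?orbT.
have lu : (corner u <= K)%N by rewrite !leq_max leqnn ?orbT.
have lv : (corner v <= K)%N by rewrite !leq_max leqnn ?orbT.
have SE i j : S (i, j) = if (j < n)%N then s (i, j) else u (i, j - n)%N.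
  rewrite moo_ofE; case: ifP => // /negbT; rewrite negb_and -!leqNgt => out.
  have [jn|nj] := ltnP j n.
    rewrite corner_out //; case/orP: out => out; first by rewrite (big s).
    by rewrite (big s j) ?orbT.
  rewrite corner_out //; case/orP: out => out; first by rewrite (big u).
  by rewrite [X in _ || X]leq_subRL // (leq_trans (lN u lu) out) orbT.
have TE i j : T (i, j) = if (i < n)%N then t (i, j) else v (i - n, j)%N.
  rewrite moo_ofE; case: ifP => // /negbT; rewrite negb_and -!leqNgt => out.
  have [jn|nj] := ltnP i n.
    rewrite corner_out //; case/orP: out => out; first by rewrite (big t).
    by rewrite (big t j) ?orbT.
  rewrite corner_out //; case/orP: out => out; last by rewrite (big v j) ?orbT.
  by rewrite leq_subRL // (leq_trans (lN v lv) out).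
have SaE i k : (S *oo moo_dsum a' b') (i, k) =
    if (k < n)%N then (s *oo a') (i, k) else (u *oo b') (i, k - n)%N.
  rewrite (@moo_mulEl S _ (n + maxn (corner u) (corner S))); last first.
    by rewrite (leq_trans (leq_maxr (corner u) _)) ?leq_addl.
  rewrite big_split_ord /=.
  under eq_bigr => l _ do rewrite SE moo_blockE ltn_ord.
  under [X in _ + X]eq_bigr => l _ do
    rewrite SE moo_blockE ltn_addl_false /= addKn.
  rewrite -/n; case: ifP => kn.
    rewrite [X in _ + X]big1 ?addr0 => [|l _]; last by rewrite rng_mulr0.
    by rewrite (@moo_mulEr _ a' n).
  rewrite big1 ?add0r => [|l _]; last by rewrite rng_mulr0.
  by rewrite -(@moo_mulEl u b' _ _ _ (leq_maxl _ _)).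
exists S, T; apply: moo_ext => i j; rewrite xE.
set A := S *oo _.
rewrite (@moo_mulEl A T (n + maxn (corner (u *oo b')) (corner A))); last first.
  by rewrite (leq_trans (leq_maxr (corner (u *oo b')) _)) ?leq_addl.
rewrite big_split_ord /=; congr (_ + _).
  rewrite (@moo_mulE _ t n).
    by apply: eq_bigr => k _; rewrite SaE TE ltn_ord.
  move=> k nk; rewrite (@moo_mulEr _ a' n) // big1 ?rng_mul0r // => l _.
  by rewrite (@corner_out a') ?rng_mulr0 // nk orbT.
rewrite (@moo_mulEl (u *oo b') v _ _ _ (leq_maxl _ (corner A))).
by apply: eq_bigr => k _; rewrite SaE TE ltn_addl_false addKn.
Qed.

Definition moo_in (I : set R) : set 'Moo(R) := [set x | forall p, I (x p)].

Definition decomposable (I : set R) :=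
  forall x, moo_in I x -> exists2 y, moo_in I y & precsim1 x y.

Definition quasipure (I : set R) :=
  forall x, moo_in I x ->
    exists s y, [/\ moo_in I s, moo_in I y, s *oo y = y & precsim1 x y].

End InfiniteMatrices.

Notation "x *oo y" := (moo_mul x y) : ring_scope.

(* T(R), with sequences indexed from 0. *)
Record Tseq (R : rngType) := MkTseq {
  tseq :> nat -> 'Moo(R);
  tseqP : forall n, precsim1 (tseq n) (tseq n.+1) }.

HB.instance Definition _ (R : rngType) := gen_eqMixin (Tseq R).
HB.instance Definition _ (R : rngType) := gen_choiceMixin (Tseq R).

Section Lambda.
Variable R : rngType.
Implicit Types x y z : Tseq R.

Definition regular_seq : set (Tseq R) :=
  [set x | forall n, exists y : 'Moo(R), x n = y *oo x n.+1 *oo x n].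

Definition precsim x y := forall n, exists m, precsim1 (x n) (y m).

Lemma precsim_refl x : precsim x x.
Proof. by move=> n; exists n.+1; exact: tseqP. Qed.

Lemma precsim_trans y x z : precsim x y -> precsim y z -> precsim x z.
Proof.
move=> xy yz n; have [m xym] := xy n; have [p yzp] := yz m.
by exists p; exact: precsim1_trans xym yzp.
Qed.

Lemma tseq_le x m n : (m < n)%N -> precsim1 (x m) (x n).
Proof.
elim: n => // n IH; rewrite ltnS leq_eqVlt => /predU1P[->|/IH xmn].
  exact: tseqP.
exact: precsim1_trans xmn (tseqP x n).
Qed.

Definition tsim : rel (Tseq R) := fun x y => `[< precsim x y /\ precsim y x >].

Lemma tsim_refl : reflexive tsim.
Proof. by move=> x; apply/asboolP; split; exact: precsim_refl. Qed.

Lemma tsim_sym : symmetric tsim.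
Proof. by move=> x y; apply/asboolP/asboolP => -[]. Qed.

Lemma tsim_trans : transitive tsim.
Proof.
move=> y x z /asboolP[xy yx] /asboolP[yz zy]; apply/asboolP.
by split; [exact: precsim_trans xy yz | exact: precsim_trans zy yx].
Qed.

Canonical tsim_equiv := EquivRel tsim tsim_refl tsim_sym tsim_trans.

Definition Lambda : Type := {eq_quot tsim}%qT.
HB.instance Definition _ := Choice.on Lambda.
HB.instance Definition _ := EqQuotient.on Lambda.

Implicit Types a b c : Lambda.
Local Notation class x := (\pi_Lambda x)%qT.

Lemma pi_eqP x y : reflect (precsim x y /\ precsim y x) (class x == class y).
Proof. by rewrite eqmodE; exact: asboolP. Qed.

Lemma repr_sim x : precsim (repr (class x)) x /\ precsim x (repr (class x)).
Proof. by apply/pi_eqP; rewrite reprK. Qed.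

Definition Lambda_le : rel Lambda := fun a b => `[< precsim (repr a) (repr b) >].

Lemma Lambda_le_refl : reflexive Lambda_le.
Proof. by move=> a; apply/asboolP; exact: precsim_refl. Qed.

Lemma Lambda_le_anti : antisymmetric Lambda_le.
Proof.
move=> a b /andP[/asboolP ab /asboolP ba].
by rewrite -[a]reprK -[b]reprK; apply/eqP/pi_eqP.
Qed.

Lemma Lambda_le_trans : transitive Lambda_le.
Proof.
move=> b a c /asboolP ab /asboolP bc; apply/asboolP; exact: precsim_trans ab bc.
Qed.

HB.instance Definition _ := Order.Le_isPOrder.Build (Order.Disp tt tt) Lambda
  Lambda_le_refl Lambda_le_anti Lambda_le_trans.

Lemma pi_leP x y : reflect (precsim x y) (class x <= class y)%O.
Proof.
have [rx xr] := repr_sim x; have [ry yr] := repr_sim y.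
apply: (iffP (asboolP _)) => xy.
  exact: precsim_trans (precsim_trans xr xy) ry.
exact: precsim_trans (precsim_trans rx xy) yr.
Qed.

Definition tdsum x y : Tseq R :=
  @MkTseq R (fun n => moo_dsum (x n) (y n))
    (fun n => precsim1_dsum (tseqP x n) (tseqP y n)).

Lemma precsim_tdsum x y x' y' :
  precsim x x' -> precsim y y' -> precsim (tdsum x y) (tdsum x' y').
Proof.
move=> xx' yy' n; have [p xp] := xx' n; have [q yq] := yy' n.
exists (maxn p q).+1; apply: precsim1_dsum.
  by apply: precsim1_trans xp _; apply: tseq_le; rewrite ltnS leq_maxl.
by apply: precsim1_trans yq _; apply: tseq_le; rewrite ltnS leq_maxr.
Qed.

Definition Lambda_add a b : Lambda := class (tdsum (repr a) (repr b)).

Lemma pi_add x y : Lambda_add (class x) (class y) = class (tdsum x y).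
Proof.
have [rx xr] := repr_sim x; have [ry yr] := repr_sim y.
by apply/eqP/pi_eqP; split; exact: precsim_tdsum.
Qed.

(* The class of the direct sum does not depend on the sizes of the corners. *)
Lemma pi_block x y (N : nat -> nat) z : (forall n, corner (x n) <= N n)%N ->
    (forall n, z n = moo_block (N n) (N n) (x n) (y n)) ->
  class z = Lambda_add (class x) (class y).
Proof.
move=> xN zE; rewrite pi_add; apply/eqP/pi_eqP; split=> n; exists n.+1.
  by rewrite zE; apply: precsim1_block => //; exact: tseqP.
by rewrite zE; apply: precsim1_block => //; exact: tseqP.
Qed.

(* regular_seq is not saturated for tsim: S(R) consists of the classes having
   some regular representative. *)
Definition S_of : set Lambda := [set class x | x in regular_seq].

Definition Lambda_of (I : set R) : set Lambda :=
  [set class x | x in [set x : Tseq R | forall n, moo_in I (x n)]].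

Definition S_of_ideal (I : set R) : set Lambda := S_of `&` Lambda_of I.

(* Suprema in the last clause are taken in Lambda(R), not in J. *)
Definition Lambda_ideal (J : set Lambda) :=
  [/\ J !=set0,
      forall a b, J a -> J b -> J (Lambda_add a b),
      forall a b, (a <= b)%O -> J b -> J a &
      forall (u : nat -> Lambda) c, (forall n, (u n <= u n.+1)%O) ->
        (forall n, J (u n)) -> supremums (range u) c -> J c].

End Lambda.

Definition cofinal_in d (P : porderType d) (X A : set P) :=
  X `<=` A /\ forall p, A p -> exists2 x, X x & (p <= x)%O.

Record latd (R : rngType) := LatD {
  latd_set :> set R;
  latd_ideal : two_sided_ideal latd_set;
  latd_decomposable : decomposable latd_set }.

HB.instance Definition _ (R : rngType) := gen_eqMixin (latd R).
HB.instance Definition _ (R : rngType) := gen_choiceMixin (latd R).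

Section LatD.
Variable R : rngType.
Implicit Types I J K : latd R.

Lemma latd_inj I J : (I : set R) = J -> I = J.
Proof.
case: I J => [I iI dI] [J iJ dJ] /= E; subst J.
by congr LatD; exact: Prop_irrelevance.
Qed.

Definition latd_le : rel (latd R) := fun I J => `[< (I : set R) `<=` J >].

Lemma latd_le_refl : reflexive latd_le.
Proof. by move=> I; apply/asboolP. Qed.

Lemma latd_le_anti : antisymmetric latd_le.
Proof.
move=> I J /andP[/asboolP IJ /asboolP JI].
by apply: latd_inj; apply/seteqP.
Qed.

Lemma latd_le_trans : transitive latd_le.
Proof.
move=> J I K /asboolP IJ /asboolP JK; apply/asboolP; exact: subset_trans IJ JK.
Qed.

HB.instance Definition _ := Order.Le_isPOrder.Build (Order.Disp tt tt) (latd R)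
  latd_le_refl latd_le_anti latd_le_trans.

Definition ideal_sum (A B : set R) : set R :=
  [set z | exists x y, [/\ A x, B y & z = x + y]].

Lemma ideal_sum_ideal (A B : set R) : two_sided_ideal A -> two_sided_ideal B ->
  two_sided_ideal (ideal_sum A B).
Proof.
move=> [A0 AB Al Ar] [B0 BB Bl Br]; split.
- by exists 0, 0; rewrite addr0.
- move=> _ _ [a [b [Aa Bb ->]]] [a' [b' [Aa' Bb' ->]]].
  by exists (a - a'), (b - b'); split; [exact: AB|exact: BB|rewrite opprD addrACA].
- move=> r _ [a [b [Aa Bb ->]]]; exists (r ** a), (r ** b).
  by split; [exact: Al|exact: Bl|rewrite rng_mulDr].
- move=> _ r [a [b [Aa Bb ->]]]; exists (a ** r), (b ** r).
  by split; [exact: Ar|exact: Br|rewrite rng_mulDl].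
Qed.

Lemma ideal_sum_decomposable (A B : set R) :
    two_sided_ideal A -> two_sided_ideal B -> decomposable A ->
  decomposable B -> decomposable (ideal_sum A B).
Proof.
move=> [A0 _ _ _] [B0 _ _ _] dA dB x xAB.
have /choice[f fP] : forall p, exists q : R * R, [/\ A q.1, B q.2 & x p = q.1 + q.2].
  by move=> p; have [a [b abP]] := xAB p; exists (a, b).
pose a := moo_of (corner x) (fun i j => (f (i, j)).1).
pose b := moo_of (corner x) (fun i j => (f (i, j)).2).
have aA : moo_in A a.
  by move=> -[i j]; rewrite moo_ofE; case: ifP => // _; case: (fP (i, j)).
have bB : moo_in B b.
  by move=> -[i j]; rewrite moo_ofE; case: ifP => // _; case: (fP (i, j)).
have [a' a'A aa'] := dA a aA; have [b' b'B bb'] := dB b bB.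
exists (moo_dsum a' b').
  move=> -[i j]; rewrite moo_blockE.
  have inA z : A z -> ideal_sum A B z by move=> Az; exists z, 0; rewrite addr0.
  have inB z : B z -> ideal_sum A B z by move=> Bz; exists 0, z; rewrite add0r.
  by case: ifP => _; case: ifP => _; [exact: inA|exact: inA|exact: inA|exact: inB].
apply: precsim1_add aa' bb' => i j; rewrite !moo_ofE; case: ifP => [_|/negbT].
  by case: (fP (i, j)).
by rewrite negb_and -!leqNgt addr0; exact: corner_out.
Qed.

Definition latd_join I J : latd R :=
  LatD (ideal_sum_ideal (latd_ideal I) (latd_ideal J))
       (ideal_sum_decomposable (latd_ideal I) (latd_ideal J)
          (@latd_decomposable R I) (@latd_decomposable R J)).

Lemma latd_leUx I J K :
  (latd_join I J <= K)%O = (I <= K)%O && (J <= K)%O.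
Proof.
have [I0 _ _ _] := latd_ideal I; have [J0 _ _ _] := latd_ideal J.
apply/asboolP/andP => [IJK|[/asboolP IK /asboolP JK]].
  split; apply/asboolP => x xI; apply: IJK; first by exists x, 0; rewrite addr0.
  by exists 0, x; rewrite add0r.
move=> _ [a [b [/IK Ka /JK Kb ->]]]; apply: ideal_add => //.
exact: latd_ideal.
Qed.

(* The intersection of two decomposable ideals need not be decomposable; the
   meet is the largest decomposable ideal contained in it. *)
Definition latd_meet_set I J : set R :=
  [set x | exists K, [/\ (K <= I)%O, (K <= J)%O & (K : set R) x]].

Lemma latd0_ideal : two_sided_ideal ([set 0] : set R).
Proof.
split=> //.
- by move=> x y -> ->; rewrite subrr.
- by move=> r _ ->; rewrite rng_mulr0.
- by move=> _ r ->; rewrite rng_mul0r.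
Qed.

Lemma latd0_decomposable : decomposable ([set 0] : set R).
Proof.
move=> x x0; exists x => //; exists x, x; apply: moo_ext => i j.
rewrite x0 (@moo_mulEl _ _ x _ _ _ (leqnn _)) big1 // => k _.
by rewrite [x (val k, j)]x0 rng_mulr0.
Qed.

Definition latd0 : latd R := LatD latd0_ideal latd0_decomposable.

Lemma latd0_le I : (latd0 <= I)%O.
Proof. by apply/asboolP => _ ->; have [] := latd_ideal I. Qed.

Lemma latd_meet_dir I J x y : latd_meet_set I J x -> latd_meet_set I J y ->
  exists K, [/\ (K <= I)%O, (K <= J)%O, (K : set R) x & (K : set R) y].
Proof.
move=> [K [KI KJ Kx]] [L [LI LJ Ly]]; exists (latd_join K L).
split; rewrite ?latd_leUx ?KI ?KJ //.
- by exists x, 0; split; rewrite ?addr0 //; have [] := latd_ideal L.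
- by exists 0, y; split; rewrite ?add0r //; have [] := latd_ideal K.
Qed.

Lemma latd_meet_ideal I J : two_sided_ideal (latd_meet_set I J).
Proof.
split.
- by exists latd0; rewrite !latd0_le.
- move=> x y Mx My; have [K [KI KJ Kx Ky]] := latd_meet_dir Mx My.
  by exists K; split=> //; have [_ + _ _] := latd_ideal K; apply.
- move=> r x [K [KI KJ Kx]]; exists K; split=> //.
  by have [_ _ + _] := latd_ideal K; apply.
- move=> x r [K [KI KJ Kx]]; exists K; split=> //.
  by have [_ _ _] := latd_ideal K; apply.
Qed.

Lemma latd_meet_decomposable I J : decomposable (latd_meet_set I J).
Proof.
move=> x xM.
have [K [KI KJ xK]] : exists K, [/\ (K <= I)%O, (K <= J)%O & moo_in K x].
  suff [K [KI KJ xK]] : exists K, [/\ (K <= I)%O, (K <= J)%O &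
      forall p, p \in (finsupp x : seq _) -> (K : set R) (x p)].
    exists K; split=> // p; have [/xK//|/fsfun_dflt->] := boolP (p \in finsupp x).
    by have [] := latd_ideal K.
  elim: (finsupp x : seq _) => [|q s [K [KI KJ xK]]].
    by exists latd0; rewrite !latd0_le.
  have [L [LI LJ Lq]] := xM q; exists (latd_join K L).
  rewrite !latd_leUx KI KJ LI LJ; split=> // p.
  rewrite inE => /predU1P[->|/xK Kp].
    by exists 0, (x q); split; rewrite ?add0r //; have [] := latd_ideal K.
  by exists (x p), 0; split; rewrite ?addr0 //; have [] := latd_ideal L.
have [y yK xy] := latd_decomposable xK; exists y => // p.
by exists K; split=> //; exact: yK.
Qed.

Definition latd_meet I J : latd R :=
  LatD (latd_meet_ideal I J) (@latd_meet_decomposable I J).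

Lemma latd_lexI K I J : (K <= latd_meet I J)%O = (K <= I)%O && (K <= J)%O.
Proof.
apply/asboolP/andP => [KM|[KI KJ]]; last by move=> x Kx; exists K.
by split; apply/asboolP => x /KM[L [/asboolP LI /asboolP LJ Lx]]; [exact: LI|exact: LJ].
Qed.

HB.instance Definition _ :=
  Order.POrder_MeetJoin_isLattice.Build (Order.Disp tt tt) (latd R) latd_lexI latd_leUx.

End LatD.

Record latSQ (R : rngType) := LatSQ {
  latSQ_pair :> set (Lambda R) * set (Lambda R);
  latSQ_ideal : Lambda_ideal latSQ_pair.1;
  latSQ_snd : latSQ_pair.2 = latSQ_pair.1 `&` @S_of R }.

HB.instance Definition _ (R : rngType) := gen_eqMixin (latSQ R).
HB.instance Definition _ (R : rngType) := gen_choiceMixin (latSQ R).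

Section LatSQ.
Variable R : rngType.
Implicit Types I J K : latSQ R.

Lemma latSQ_inj I J : I.1 = J.1 -> I = J.
Proof.
case: I J => [[I1 I2] iI dI] [[J1 J2] iJ dJ] /= E.
move: (dI) (dJ); rewrite /= => E1 E2; subst J1 I2 J2.
by congr LatSQ; exact: Prop_irrelevance.
Qed.

Definition latSQ_le : rel (latSQ R) :=
  fun I J => `[< I.1 `<=` J.1 /\ I.2 `<=` J.2 >].

Lemma latSQ_leP I J : reflect (I.1 `<=` J.1) (latSQ_le I J).
Proof.
apply: (iffP (asboolP _)) => [[]//|IJ]; split=> //.
by rewrite !latSQ_snd => a [/IJ].
Qed.

Lemma latSQ_le_refl : reflexive latSQ_le.
Proof. by move=> I; apply/latSQ_leP. Qed.

Lemma latSQ_le_anti : antisymmetric latSQ_le.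
Proof.
move=> I J /andP[/latSQ_leP IJ /latSQ_leP JI].
by apply: latSQ_inj; apply/seteqP.
Qed.

Lemma latSQ_le_trans : transitive latSQ_le.
Proof.
move=> J I K /latSQ_leP IJ /latSQ_leP JK.
by apply/latSQ_leP; exact: subset_trans IJ JK.
Qed.

HB.instance Definition _ := Order.Le_isPOrder.Build (Order.Disp tt tt) (latSQ R)
  latSQ_le_refl latSQ_le_anti latSQ_le_trans.

Lemma tseq0P (n : nat) : precsim1 ([fsfun] : 'Moo(R)) [fsfun].
Proof.
exists [fsfun], [fsfun]; apply: moo_ext => i j.
rewrite (@moo_mulEr _ _ _ _ _ _ (leqnn _)) big1 ?fsfunE // => k _.
by rewrite [[fsfun] (val k, j)]fsfunE rng_mulr0.
Qed.

Definition Lambda0 : Lambda R :=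
  (\pi_(Lambda R) (MkTseq tseq0P))%qT.

Lemma Lambda0_le (a : Lambda R) : (Lambda0 <= a)%O.
Proof.
rewrite -[a]reprK; apply/pi_leP => n; exists n, [fsfun], [fsfun].
apply: moo_ext => i j /=.
rewrite (@moo_mulEr _ _ _ _ _ _ (leqnn _)) big1 ?fsfunE // => k _.
by rewrite [[fsfun] (val k, j)]fsfunE rng_mulr0.
Qed.

Lemma Lambda_ideal0 (J : set (Lambda R)) : Lambda_ideal J -> J Lambda0.
Proof. by case=> -[a Ja] _ Jle _; apply: Jle Ja; exact: Lambda0_le. Qed.

Lemma Lambda_ideal_bigcap (F : set (set (Lambda R))) :
  F `<=` @Lambda_ideal R -> Lambda_ideal (\bigcap_(J in F) J).
Proof.
move=> Fi; split.
- by exists Lambda0 => J FJ; apply: Lambda_ideal0; exact: Fi.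
- move=> a b Fa Fb J FJ; have [_ + _ _] := Fi _ FJ; apply; first exact: Fa.
  exact: Fb.
- move=> a b ab Fb J FJ; have [_ _ + _] := Fi _ FJ; apply; first exact: ab.
  exact: Fb.
- move=> u c ui uF uc J FJ; have [_ _ _] := Fi _ FJ; apply; [exact: ui| |exact: uc].
  by move=> n; exact: uF.
Qed.

Definition latSQ_of (J : set (Lambda R)) (iJ : Lambda_ideal J) : latSQ R :=
  @LatSQ R (J, J `&` @S_of R) iJ erefl.

Lemma latSQ_meet_ideal I J : Lambda_ideal (I.1 `&` J.1).
Proof.
have -> : I.1 `&` J.1 = \bigcap_(K in [set I.1; J.1]) K.
  by rewrite bigcap_setU !bigcap_set1.
by apply: Lambda_ideal_bigcap => K [->|->]; exact: latSQ_ideal.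
Qed.

Definition latSQ_meet I J : latSQ R := latSQ_of (latSQ_meet_ideal I J).

Lemma latSQ_join_ideal I J : Lambda_ideal
  (\bigcap_(K in [set K | Lambda_ideal K /\ I.1 `|` J.1 `<=` K]) K).
Proof. by apply: Lambda_ideal_bigcap => K []. Qed.

Definition latSQ_join I J : latSQ R := latSQ_of (latSQ_join_ideal I J).

Lemma latSQ_lexI K I J : (K <= latSQ_meet I J)%O = (K <= I)%O && (K <= J)%O.
Proof.
apply/latSQ_leP/andP => [KM|[/latSQ_leP KI /latSQ_leP KJ]].
  by split; apply/latSQ_leP => a /KM[].
by move=> a Ka; split; [exact: KI|exact: KJ].
Qed.

Lemma latSQ_leUx I J K : (latSQ_join I J <= K)%O = (I <= K)%O && (J <= K)%O.
Proof.
apply/latSQ_leP/andP => [MK|[/latSQ_leP IK /latSQ_leP JK]].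
  by split; apply/latSQ_leP => a Ia; apply: MK => L [_]; apply; [left|right].
move=> a; apply; split; first exact: latSQ_ideal.
by move=> b [/IK|/JK].
Qed.

HB.instance Definition _ :=
  Order.POrder_MeetJoin_isLattice.Build (Order.Disp tt tt) (latSQ R) latSQ_lexI latSQ_leUx.

End LatSQ.

(* Main.v *)
Require Import Defs.
From mathcomp Require Import all_boot order.
From mathcomp Require Import ssralg generic_quotient finmap boolp classical_sets.

(** The inverse of I |-> Lambda_of I sends an ideal J of Lambda(R) to the set
    of those r in R for which the matrix with the single entry r, in the
    corner, lies below some term of a sequence whose class is in J.

    That this works rests on one description of the matrices a lying below such
    a term ([dominated J]): they are exactly the matrices all of whose entries
    belong to the set just described ([dominatedP]).  Indeed if a = s y t, then
    moving a row of s and a column of t isolates any entry of a in any position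
    ([precsim1_entry]); conversely a is the sum of its entries, and a sum lies
    below the direct sum of bounds of its summands.  No unit is needed, since
    only the factors s and t are modified.  As the terms of a sequence form a
    chain for precsim1, the ideal obtained is decomposable.

    A sequence x with entries in that ideal has each x n below a term of some
    y n with class in J; the classes of y 0 + ... + y n increase, so their
    supremum is in J, and it bounds the class of x.  This uses that increasing
    sequences in Lambda(R) have suprema given by diagonal sequences of terms
    ([tseq_sup]), which is also what makes Lambda_of I closed under suprema.
    Conversely, decomposability of I lets one start a sequence in M_oo(I) from
    any r in I, so that I is recovered from Lambda_of I.  Both maps preserve
    inclusion, hence the bijection preserves meets and joins.

    If S(I) is cofinal and y is a regular sequence in M_oo(I) above a given
    matrix a, then y m = (w y (m+1)) (y m) exhibits the left unit that
    quasipurity requires.  Conversely, quasipurity produces from a sequence x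
    left units s n and matrices y n >= x n with s n y n = y n and s n = a (y
    (n+1)) b; the sequence y n itself need not be regular, but b (y n) is
    ([quasipure_cofinal]). *)

Set Implicit Arguments.
Unset Strict Implicit.
Unset Printing Implicit Defensive.

Import Order.TTheory GRing.Theory.

Local Open Scope classical_set_scope.
Local Open Scope ring_scope.

Local Notation class x := (\pi_(Lambda _) x)%qT.

Lemma dependent_choice_nat (T : Type) (G : nat -> T -> Prop)
    (E : nat -> T -> T -> Prop) x0 :
  G 0%N x0 -> (forall n x, G n x -> exists2 y, G n.+1 y & E n x y) ->
  exists u : nat -> T,
    [/\ u 0%N = x0, forall n, G n (u n) & forall n, E n (u n) (u n.+1)].
Proof.
move=> G0 step.
have /choice[F FP] : forall p : nat * T, exists y,
    G p.1 p.2 -> G p.1.+1 y /\ E p.1 p.2 y.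
  move=> [n x]; have [/step[y Gy xy]|nG] := pselect (G n x); first by exists y.
  by exists x.
pose u n := iteri n (fun k x => F (k, x)) x0.
have Gu n : G n (u n) by elim: n => [//|n /(FP (n, _))[]].
by exists u; split=> // n; case: (FP (n, u n) (Gu n)).
Qed.

(** * Comparison of infinite matrices *)

Section Matrices.
Variable R : rngType.
Implicit Types (a b x y z s t : 'Moo(R)) (I : set R).

(** The bound n depends on the middle factor only, so s and t may be altered
    outside their first n columns, respectively rows, at no cost. *)
Lemma moo_mul3E s y t n i j : (corner y <= n)%N ->
  (s *oo y *oo t) (i, j) =
  \sum_(k < n) (\sum_(l < n) s (i, val l) ** y (val l, val k)) ** t (val k, j).
Proof.
move=> yn; rewrite (@moo_mulE _ _ _ n) => [|k nk]; last first.
  rewrite (moo_mulEr _ _ _ yn) big1 ?rng_mul0r // => l _.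
  by rewrite (@corner_out _ y) ?rng_mulr0 // (leq_trans yn nk) orbT.
by apply: eq_bigr => k _; rewrite (moo_mulEr _ _ _ yn).
Qed.

Lemma precsim1_mull x y z : precsim1 x y -> precsim1 (z *oo x) y.
Proof. by move=> [s [t ->]]; exists (z *oo s), t; rewrite !moo_mulA. Qed.

Lemma precsim1_mulr x y z : precsim1 x y -> precsim1 (x *oo z) y.
Proof. by move=> [s [t ->]]; exists s, (t *oo z); rewrite !moo_mulA. Qed.

Lemma precsim1_0 x y : (forall p, x p = 0) -> precsim1 x y.
Proof.
move=> x0; exists x, y; apply: moo_ext => i j.
rewrite (@moo_mul3E _ _ _ (corner y)) // big1 ?x0 // => k _.
by rewrite big1 ?rng_mul0r // => l _; rewrite x0 rng_mul0r.
Qed.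

Lemma precsim1_opp x y z :
  (forall p, x p = - y p) -> precsim1 y z -> precsim1 x z.
Proof.
move=> xE [s [t yE]].
have mulNr u v : (- u) ** v = - (u ** v) :> R.
  by apply: (addrI (u ** v)); rewrite -rng_mulDl !subrr rng_mul0r.
pose S := moo_of (corner s) (fun i j => - s (i, j)).
have SE i j : S (i, j) = - s (i, j).
  rewrite moo_ofE; case: ifP => // /negbT; rewrite negb_and -!leqNgt => out.
  by rewrite corner_out // oppr0.
exists S, t; apply: moo_ext => i j.
rewrite xE yE !(@moo_mul3E _ _ _ (corner z)) // -sumrN; apply: eq_bigr => k _.
rewrite -mulNr -sumrN; congr (_ ** _).
by apply: eq_bigr => l _; rewrite SE mulNr.
Qed.

(** In a ring without unit x need not lie below x itself, so it need not lie
    below diag(x, z) either; some y above x is required. *)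
Lemma precsim1_dsuml x y z : precsim1 x y -> precsim1 x (moo_dsum y z).
Proof.
move=> xy; apply: (@precsim1_add _ x x [fsfun]) => //.
  by move=> i j; rewrite fsfunE addr0.
by apply: precsim1_0 => p; rewrite fsfunE.
Qed.

Lemma precsim1_dsumr x y z : precsim1 x z -> precsim1 x (moo_dsum y z).
Proof.
move=> xz; apply: (@precsim1_add _ x [fsfun] x) => //.
  by move=> i j; rewrite fsfunE add0r.
by apply: precsim1_0 => p; rewrite fsfunE.
Qed.

Definition moo_single (p : nat * nat) (r : R) : 'Moo(R) :=
  [fsfun ([fsfun] : 'Moo(R)) with p |-> r].

Lemma moo_singleE p r q : moo_single p r q = if q == p then r else 0.
Proof. by rewrite fsfun_withE fsfunE. Qed.

Lemma moo_single_mull p r r' :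
  moo_single p (r ** r') = moo_single (p.1, 0%N) r *oo moo_single (0%N, p.2) r'.
Proof.
case: p => p1 p2; apply: moo_ext => i j.
rewrite (@moo_mulE _ _ _ 1) => [|[|k] // _]; last first.
  by rewrite moo_singleE xpair_eqE andbF rng_mul0r.
rewrite big_ord1 !moo_singleE !xpair_eqE /= andbT.
by case: (i == p1); case: (j == p2); rewrite ?rng_mul0r ?rng_mulr0.
Qed.

(** If x = s z t, then row p.1 of S is row q.1 of s, column p.2 of T is column
    q.2 of t, and S z T has the entry x q in position p and zeros elsewhere. *)
Lemma precsim1_entry p q x z : precsim1 x z -> precsim1 (moo_single p (x q)) z.
Proof.
case: p q => [p1 p2] [q1 q2] [s [t ->]].
set n := corner z.
pose S := moo_of (maxn p1.+1 n) (fun i l => if i == p1 then s (q1, l) else 0).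
pose T := moo_of (maxn p2.+1 n) (fun l j => if j == p2 then t (l, q2) else 0).
have SE i l : (l < n)%N -> S (i, l) = if i == p1 then s (q1, l) else 0.
  move=> ln; rewrite moo_ofE !leq_max ln orbT andbT.
  by case: (eqVneq i p1) => [->|_]; rewrite ?leqnn //; case: ifP.
have TE l j : (l < n)%N -> T (l, j) = if j == p2 then t (l, q2) else 0.
  move=> ln; rewrite moo_ofE !leq_max ln orbT /=.
  by case: (eqVneq j p2) => [->|_]; rewrite ?leqnn //; case: ifP.
exists S, T; apply: moo_ext => i j.
rewrite moo_singleE xpair_eqE !(@moo_mul3E _ _ _ n) //.
under [RHS]eq_bigr => k _ do
  (rewrite TE ?ltn_ord //; under eq_bigr => l _ do rewrite SE ?ltn_ord //).
case: (i == p1) => /=; last first.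
  by rewrite big1 // => k _; rewrite big1 ?rng_mul0r // => l _; rewrite rng_mul0r.
by case: (j == p2) => //; rewrite big1 // => k _; rewrite rng_mulr0.
Qed.

Lemma ideal_sumr I n (F : 'I_n -> R) :
  two_sided_ideal I -> (forall i, I (F i)) -> I (\sum_i F i).
Proof.
move=> iI IF; apply: (big_ind I) => //; first by case: iI.
by move=> u v; exact: ideal_add.
Qed.

Lemma moo_in_mull I x y : two_sided_ideal I -> moo_in I y -> moo_in I (x *oo y).
Proof.
move=> iI yI [i j]; rewrite (moo_mulEl _ _ _ (leqnn _)).
by apply: ideal_sumr => // k; case: iI => _ _ + _; apply.
Qed.

Lemma moo_in_mulr I x y : two_sided_ideal I -> moo_in I x -> moo_in I (x *oo y).
Proof.
move=> iI xI [i j]; rewrite (moo_mulEl _ _ _ (leqnn _)).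
by apply: ideal_sumr => // k; case: iI => _ _ _; apply.
Qed.

Lemma moo_in_precsim1 I x y :
  two_sided_ideal I -> precsim1 x y -> moo_in I y -> moo_in I x.
Proof. by move=> iI [s [t ->]] yI; apply: moo_in_mulr => //; exact: moo_in_mull. Qed.

Lemma moo_in_dsum I x y : two_sided_ideal I ->
  moo_in I x -> moo_in I y -> moo_in I (moo_dsum x y).
Proof.
move=> [I0 _ _ _] xI yI [i j]; rewrite moo_blockE.
by case: ifP => _; case: ifP => _; [exact: xI|exact: I0|exact: I0|exact: yI].
Qed.

Lemma moo_in_single I p r : I 0 -> I r -> moo_in I (moo_single p r).
Proof. by move=> I0 Ir q; rewrite moo_singleE; case: ifP. Qed.

Lemma decomposable_tseq I x : decomposable I -> moo_in I x ->
  exists2 u : Tseq R, u 0%N = x & forall n, moo_in I (u n).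
Proof.
move=> dI xI.
have [|u [u0 uI uu]] := @dependent_choice_nat _ (fun=> moo_in I)
  (fun _ => @precsim1 R) x xI; first by move=> n y /dI.
by exists (MkTseq uu).
Qed.

End Matrices.

(** * Suprema *)

Section Suprema.
Variable R : rngType.
Implicit Types (x y z : Tseq R) (u : nat -> Tseq R).

Lemma precsim_common z (a : nat -> 'Moo(R)) n :
  (forall i, (i <= n)%N -> exists m, precsim1 (a i) (z m)) ->
  exists m, forall i, (i <= n)%N -> precsim1 (a i) (z m).
Proof.
elim: n => [|n IH] az.
  by have [m am] := az 0%N (leqnn _); exists m => i; rewrite leqn0 => /eqP ->.
have [|m am] := IH; first by move=> i ile; apply: az; exact: leqW.
have [k ak] := az n.+1 (leqnn _).
exists (maxn m k).+1 => i; rewrite leq_eqVlt => /predU1P[->|/am ai].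
  by apply: precsim1_trans ak _; apply: tseq_le; rewrite ltnS leq_maxr.
by apply: precsim1_trans ai _; apply: tseq_le; rewrite ltnS leq_maxl.
Qed.

Lemma precsim_homo u : (forall n, precsim (u n) (u n.+1)) ->
  forall m n, (m <= n)%N -> precsim (u m) (u n).
Proof.
move=> uu m n /subnK <-; elim: (n - m)%N => [|k IH].
  exact: precsim_refl.
exact: precsim_trans IH (uu _).
Qed.

(** The supremum is a diagonal sequence z n = u n (f n), where f grows fast
    enough for z (n+1) to dominate z n and all the terms u i n with i <= n.
    That each z n is a term of some u m makes z a least upper bound and shows
    that its terms lie in M_oo(I) as soon as those of all the u m do. *)
Lemma tseq_sup u : (forall n, precsim (u n) (u n.+1)) ->
  exists z, (forall n, precsim (u n) z) /\
            (forall n, exists m k, z n = u m k).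
Proof.
move=> uu; have umono := precsim_homo uu.
pose E n m m' := precsim1 (u n m) (u n.+1 m') /\
  forall i, (i <= n)%N -> precsim1 (u i n) (u n.+1 m').
have [|f [_ _ fE]] := @dependent_choice_nat nat (fun _ _ => True) E 0%N I.
  move=> n m _.
  (* The index (maxn n m).+1 exceeds both n and m, hence u i (maxn n m).+1
     dominates u i n for all i <= n, and u n m when i = n. *)
  have [|m' m'P] := @precsim_common (u n.+1) (fun i => u i (maxn n m).+1) n.
    by move=> i ile; apply: umono; exact: leqW.
  exists m' => //; split=> [|i ile].
    by apply: precsim1_trans (m'P n (leqnn n)); apply: tseq_le; rewrite ltnS leq_maxr.
  by apply: precsim1_trans (m'P i ile); apply: tseq_le; rewrite ltnS leq_maxl.
exists (@MkTseq R (fun n => u n (f n)) (fun n => (fE n).1)); split; last first.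
  by move=> n; exists n, (f n).
move=> n i; exists (maxn n i).+2 => /=.
apply: precsim1_trans ((fE (maxn n i).+1).2 n _); last by rewrite leqW // leq_maxl.
by apply: tseq_le; rewrite ltnS leq_maxr.
Qed.

Lemma supremums_class u z : (forall n, precsim (u n) z) ->
    (forall n, exists m k, z n = u m k) ->
  supremums (range (fun n => class (u n) : Lambda R)) (class z).
Proof.
move=> uz zu; split=> [_ [n _ <-]|c ub]; first exact/pi_leP.
rewrite -[c]reprK; apply/pi_leP => n; have [m [k ->]] := zu n.
have /pi_leP : (class (u m) <= class (repr c))%O by rewrite reprK; apply: ub; exists m.
exact.
Qed.

End Suprema.

(** * From ideals of the ring to ideals of Lambda *)

Section RingToLambda.
Variable R : rngType.
Implicit Types (x y z : Tseq R) (I : set R).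

(** Membership can be tested on any representative, since matrices below a
    matrix over an ideal are matrices over that ideal. *)
Lemma Lambda_ofP I x : two_sided_ideal I ->
  Lambda_of I (class x) <-> forall n, moo_in I (x n).
Proof.
move=> iI; split=> [[y yI /eqP/pi_eqP[_ xy]] n|xI]; last by exists x.
by have [m xm] := xy n; exact: moo_in_precsim1 xm (yI m).
Qed.

Lemma Lambda_of_le I (a b : Lambda R) : two_sided_ideal I ->
  (a <= b)%O -> Lambda_of I b -> Lambda_of I a.
Proof.
move=> iI; rewrite -[a]reprK -[b]reprK => /pi_leP ab /(Lambda_ofP _ iI) bI.
apply/Lambda_ofP => // n.
by have [m nm] := ab n; exact: moo_in_precsim1 nm (bI m).
Qed.

Lemma Lambda_of_ideal I : two_sided_ideal I -> Lambda_ideal (Lambda_of I).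
Proof.
move=> iI; have [I0 _ _ _] := iI; split.
- by exists (class (MkTseq (@tseq0P R))); exists (MkTseq (@tseq0P R)) => // n p; rewrite fsfunE.
- move=> a b; rewrite -[a]reprK -[b]reprK.
  move=> /(Lambda_ofP _ iI) aI /(Lambda_ofP _ iI) bI.
  by rewrite pi_add; apply/Lambda_ofP => // n; exact: moo_in_dsum.
- by move=> a b; exact: Lambda_of_le.
- move=> u c uu uI [_ c_least].
  have [|z [uz zu]] := @tseq_sup R (fun n => repr (u n)).
    by move=> n; apply/pi_leP; rewrite !reprK.
  apply: (@Lambda_of_le I c (class z)) => //.
    by apply: c_least => _ [n _ <-]; rewrite -[u n]reprK; apply/pi_leP.
  apply/Lambda_ofP => // n; have [m [k ->]] := zu n.
  by move: k; apply/Lambda_ofP; rewrite ?reprK.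
Qed.

End RingToLambda.

(** * From ideals of Lambda to ideals of the ring *)

Section LambdaToRing.
Variable R : rngType.
Variable J : set (Lambda R).
Hypothesis iJ : Lambda_ideal J.
Implicit Types (a b c : 'Moo(R)) (x y z : Tseq R).

Definition dominated : set 'Moo(R) :=
  [set a | exists2 x : Tseq R, J (class x) & exists n, precsim1 a (x n)].

Definition entry_ideal : set R := [set r | dominated (moo_single (0%N, 0%N) r)].

Lemma dominated_le a b : precsim1 a b -> dominated b -> dominated a.
Proof.
by move=> ab [x Jx [n bx]]; exists x => //; exists n; exact: precsim1_trans ab bx.
Qed.

Lemma dominated_add a b c : (forall p, c p = a p + b p) ->
  dominated a -> dominated b -> dominated c.
Proof.
move=> cE [x Jx [n ax]] [y Jy [m bY]]; exists (tdsum x y).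
  by rewrite -pi_add; have [_ + _ _] := iJ; apply.
exists (maxn n m).+1; apply: (@precsim1_add _ c a b) => //.
  by apply: precsim1_trans ax _; apply: tseq_le; rewrite ltnS leq_maxl.
by apply: precsim1_trans bY _; apply: tseq_le; rewrite ltnS leq_maxr.
Qed.

Lemma dominated_0 a : (forall p, a p = 0) -> dominated a.
Proof.
move=> a0; have [[c Jc] _ _ _] := iJ.
by exists (repr c); [rewrite reprK|exists 0%N; exact: precsim1_0].
Qed.

Lemma dominated_mull a b : dominated a -> dominated (b *oo a).
Proof. by move=> [x Jx [n ax]]; exists x => //; exists n; exact: precsim1_mull. Qed.

Lemma dominated_mulr a b : dominated a -> dominated (a *oo b).
Proof. by move=> [x Jx [n ax]]; exists x => //; exists n; exact: precsim1_mulr. Qed.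

Lemma dominated_entry p q a : dominated a -> dominated (moo_single p (a q)).
Proof. by move=> [x Jx [n ax]]; exists x => //; exists n; exact: precsim1_entry. Qed.

Lemma dominated_opp a b : (forall p, b p = - a p) -> dominated a -> dominated b.
Proof.
by move=> bE [x Jx [n ax]]; exists x => //; exists n; exact: precsim1_opp ax.
Qed.

Lemma entry_ideal_ideal : two_sided_ideal entry_ideal.
Proof.
split.
- by apply: dominated_0 => p; rewrite moo_singleE; case: ifP.
- move=> r r' /= rJ r'J.
  apply: (@dominated_add _ (moo_single (0, 0)%N (- r'))) rJ _.
    by move=> p; rewrite !moo_singleE; case: ifP; rewrite ?addr0.
  apply: dominated_opp r'J => p.
  by rewrite !moo_singleE; case: ifP; rewrite ?oppr0.
- by move=> r r' r'J; rewrite /entry_ideal /= moo_single_mull; exact: dominated_mull.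
- by move=> r r' rJ; rewrite /entry_ideal /= moo_single_mull; exact: dominated_mulr.
Qed.

(** From right to left, a is built up entry by entry on a list containing its
    support. *)
Lemma dominatedP a : dominated a <-> moo_in entry_ideal a.
Proof.
split=> [aJ p|aJ]; first exact: dominated_entry.
have {aJ} aJ p : dominated (moo_single p (a p)).
  by have := dominated_entry p (0, 0)%N (aJ p); rewrite moo_singleE eqxx.
have [s] : exists s : seq (nat * nat), forall p, p \notin s -> a p = 0.
  by exists (finsupp a) => p; exact: fsfun_dflt.
elim: s a aJ => [|q s IH] a aJ a0.
  by apply: dominated_0 => p; apply: a0.
apply: (@dominated_add (moo_single q (a q)) [fsfun a with q |-> 0]).
- move=> p; rewrite moo_singleE fsfun_withE.
  by case: eqP => [->|_]; rewrite ?addr0 ?add0r.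
- exact: aJ.
- apply: IH => p.
    rewrite fsfun_withE; case: eqP => _; last exact: aJ.
    by apply: dominated_0 => p'; rewrite moo_singleE; case: ifP.
  rewrite fsfun_withE; case: eqP => // /eqP pq ps.
  by apply: a0; rewrite inE negb_or pq.
Qed.

Lemma entry_ideal_decomposable : decomposable entry_ideal.
Proof.
move=> a /dominatedP[x Jx [n ax]]; exists (x n) => //.
by apply/dominatedP; exists x => //; exists n.+1; exact: tseqP.
Qed.

Definition latd_of_Lambda : latd R :=
  LatD entry_ideal_ideal entry_ideal_decomposable.

(** The nontrivial inclusion: each term of x lies below a term of some sequence
    of J, and these countably many sequences have a common bound in J, the
    supremum of their finite sums. *)
Lemma Lambda_of_entry_ideal : Lambda_of entry_ideal = J.
Proof.
apply/seteqP; split=> a; rewrite -[a]reprK; set x := repr a; last first.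
  move=> Jx; exists x => // n; apply/dominatedP.
  by exists x => //; exists n.+1; exact: tseqP.
move=> /(Lambda_ofP _ entry_ideal_ideal) xJ.
have /choice[y yP] : forall n, exists y,
    J (class y) /\ exists m, precsim1 (x n) (y m).
  by move=> n; have /dominatedP[y Jy xy] := xJ n; exists y.
pose u := fix u n := if n is k.+1 then tdsum (u k) (y n) else y 0%N.
have Ju n : J (class (u n)).
  elim: n => [|n IH]; first by case: (yP 0%N).
  by rewrite /= -pi_add; have [_ + _ _] := iJ; apply => //; case: (yP n.+1).
have uu n : precsim (u n) (u n.+1).
  by move=> k; exists k.+1; apply: precsim1_dsuml; exact: tseqP.
have yu n : precsim (y n) (u n).
  case: n => [|n]; first exact: precsim_refl.
  by move=> k; exists k.+1; apply: precsim1_dsumr; exact: tseqP.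
have [z [uz zu]] := tseq_sup uu.
have [_ _ Jle Jsup] := iJ.
apply: Jle (_ : class x <= class z)%O _.
  apply/pi_leP => n; have [_ [m xm]] := yP n.
  have [k ymk] := yu n m; have [l ukl] := uz n k; exists l.
  exact: precsim1_trans xm (precsim1_trans ymk ukl).
apply: (Jsup (fun n => class (u n))); [|exact: Ju|exact: supremums_class].
by move=> n; apply/pi_leP.
Qed.

End LambdaToRing.

(** * The lattice isomorphism *)

Section Isomorphism.
Variable R : rngType.
Implicit Types (I K : latd R) (L : latSQ R).

Definition latSQ_of_latd I : latSQ R :=
  @LatSQ R (Lambda_of I, S_of_ideal I) (Lambda_of_ideal (latd_ideal I))
    (setIC _ _).

Definition latd_of_latSQ L : latd R := latd_of_Lambda (latSQ_ideal L).

Lemma latSQ_of_latdK : cancel latSQ_of_latd latd_of_latSQ.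
Proof.
move=> I; have iI := latd_ideal I; have [I0 _ _ _] := iI.
apply: latd_inj; apply/seteqP; split=> r /=.
  move=> [x /= /(Lambda_ofP _ iI) xI [n rx]].
  by have := moo_in_precsim1 iI rx (xI n) (0, 0)%N; rewrite moo_singleE eqxx.
move=> Ir; have [u u0 uI] := decomposable_tseq (@latd_decomposable _ I)
  (moo_in_single (0, 0)%N I0 Ir).
exists u; first exact/Lambda_ofP.
by exists 1%N; rewrite -u0; exact: tseqP.
Qed.

Lemma latd_of_latSQK : cancel latd_of_latSQ latSQ_of_latd.
Proof. by move=> L; apply: latSQ_inj; exact: (Lambda_of_entry_ideal (latSQ_ideal L)). Qed.

Lemma latSQ_of_latd_homo : {homo latSQ_of_latd : I K / (I <= K)%O}.
Proof.
move=> I K /asboolP IK; apply/latSQ_leP => _ [x xI <-].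
by exists x => // n p; apply: IK; exact: xI.
Qed.

Lemma latd_of_latSQ_homo : {homo latd_of_latSQ : L M / (L <= M)%O}.
Proof.
move=> L M /latSQ_leP LM; apply/asboolP => r [x Lx rx].
by exists x => //; exact: LM.
Qed.

Lemma latSQ_of_latd_mono : {mono latSQ_of_latd : I K / (I <= K)%O}.
Proof.
move=> I K; apply/idP/idP; last exact: latSQ_of_latd_homo.
by move=> /latd_of_latSQ_homo; rewrite !latSQ_of_latdK.
Qed.

Lemma latSQ_of_latd_meet : {morph latSQ_of_latd : I K / (I `&` K)%O}.
Proof.
move=> I K; apply/eqP; rewrite eq_le lexI !latSQ_of_latd_mono leIl leIr /=.
rewrite -[X in (X <= _)%O]latd_of_latSQK latSQ_of_latd_mono lexI.
by rewrite -!latSQ_of_latd_mono latd_of_latSQK leIl leIr.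
Qed.

Lemma latSQ_of_latd_join : {morph latSQ_of_latd : I K / (I `|` K)%O}.
Proof.
move=> I K; apply/eqP; rewrite eq_le andbC leUx !latSQ_of_latd_mono leUl leUr /=.
rewrite -[X in (_ <= X)%O]latd_of_latSQK latSQ_of_latd_mono leUx.
by rewrite -!latSQ_of_latd_mono latd_of_latSQK leUl leUr.
Qed.

End Isomorphism.

(** * Quasipure ideals *)

Section Quasipure.
Variable R : rngType.
Implicit Types (I : latd R) (x y : Tseq R).

Lemma cofinal_quasipure I :
  cofinal_in (S_of_ideal I) (Lambda_of I) -> quasipure I.
Proof.
have iI := latd_ideal I; move=> [_ cof] a aI.
have [x x0 xI] := decomposable_tseq (@latd_decomposable _ I) aI.
have /cof[_ [[y yreg <-] /(Lambda_ofP _ iI) yI]] : Lambda_of I (class x) by exists x.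
move=> /pi_leP /(_ 0%N)[m]; rewrite x0 => ay; have [w yE] := yreg m.
exists (w *oo y m.+1), (y m); split=> //.
exact: moo_in_mull.
Qed.

(** Quasipurity is applied to the single matrix diag(s1, a1), where s1 and a1
    lie above s and a by decomposability. *)
Lemma quasipure_local_unit I (s a : 'Moo(R)) : quasipure I ->
    moo_in I s -> moo_in I a ->
  exists s' b, [/\ moo_in I s', moo_in I b, s' *oo b = b, precsim1 s b &
    precsim1 a b].
Proof.
have iI := latd_ideal I; move=> qI sI aI.
have [s1 s1I ss1] := latd_decomposable sI.
have [a1 a1I aa1] := latd_decomposable aI.
have [s' [b [s'I bI s'b sa]]] := qI _ (moo_in_dsum iI s1I a1I).
exists s', b; split=> //; apply: precsim1_trans sa.
  exact: precsim1_dsuml.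
exact: precsim1_dsumr.
Qed.

(** Write y_n for (f n).2 and s_n for (f n).1.  From s_n y_n = y_n and
    s_n = a_n y_(n+1) b_n one gets y_n = a_n y_(n+1) (b_n y_n), where the left
    factor involves y_(n+1) but the right one b_n y_n.  Replacing y_n by
    b_n y_n for all n, and expanding y_(n+1) once more in the same way,
    restores the shape w (b_(n+1) y_(n+1)) (b_n y_n) of a regular sequence. *)
Lemma quasipure_cofinal I :
  quasipure I -> cofinal_in (S_of_ideal I) (Lambda_of I).
Proof.
have iI := latd_ideal I.
move=> qI; split=> [c []//|_ [x xI <-]].
pose G n (p : 'Moo(R) * 'Moo(R)) :=
  [/\ moo_in I p.1, moo_in I p.2, p.1 *oo p.2 = p.2 & precsim1 (x n) p.2].
pose E (n : nat) (p q : 'Moo(R) * 'Moo(R)) := precsim1 p.1 q.2.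
have [s0 [y0 G0]] := qI _ (xI 0%N).
have [|f [_ fG fE]] := @dependent_choice_nat _ G E (s0, y0) G0.
  move=> n [s y] [sI _ _ _].
  have [s' [y' [s'I y'I s'y' sy' xy']]] := quasipure_local_unit qI sI (xI n.+1).
  by exists (s', y').
have /choice[g gE] : forall n, exists ab : 'Moo(R) * 'Moo(R),
    (f n).1 = ab.1 *oo (f n.+1).2 *oo ab.2.
  by move=> n; have [a [b ab]] := fE n; exists (a, b).
pose y n := (g n).2 *oo (f n).2.
have fy n : (f n).2 = (g n).1 *oo (f n.+1).2 *oo y n.
  by have [_ _ sy _] := fG n; rewrite /y moo_mulA -gE sy.
have yreg n : y n = ((g n).2 *oo (g n).1 *oo (g n.+1).1 *oo (f n.+2).2)
    *oo y n.+1 *oo y n.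
  by rewrite {1}/y {1}fy {1}fy !moo_mulA.
have yprec n : precsim1 (y n) (y n.+1) by rewrite yreg; do 2!eexists.
have yI n : moo_in I (y n) by apply: moo_in_mull => //; case: (fG n).
exists (class (MkTseq yprec)).
  split; last by exists (MkTseq yprec).
  by exists (MkTseq yprec) => // n; eexists; exact: yreg.
apply/pi_leP => n; have [_ _ _ xn] := fG n; exists n.+1.
by apply: precsim1_trans xn _; rewrite fy; exact: precsim1_mull.
Qed.

End Quasipure.

Theorem theoremB (R : rngType) :
  (exists f : latd R -> latSQ R,
    [/\ forall I : latd R,
          latSQ_pair (f I) = (Lambda_of (latd_set I), S_of_ideal (latd_set I)),
        bijective f,
        {morph f : I J / Order.meet I J} &
        {morph f : I J / Order.join I J}]) /\
  (forall I : latd R,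
    quasipure (latd_set I) <->
    cofinal_in (S_of_ideal (latd_set I)) (Lambda_of (latd_set I))).
Proof.
split; last by move=> I; split; [exact: quasipure_cofinal|exact: cofinal_quasipure].
exists (@latSQ_of_latd R); split=> //.
- by exists (@latd_of_latSQ R); [exact: latSQ_of_latdK|exact: latd_of_latSQK].
- exact: latSQ_of_latd_meet.
- exact: latSQ_of_latd_join.
Qed.
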